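(* Let $n\ge 3$ be an integer, let $C_n$ be the $n$-cycle graph, and let $\rho_{C_n}$ be the Paley index of $C_n$. Let \[ \lceil n\rceil_{\mathbb{F}}=\min\{q\in\mathbb{N}\mid n\le q,\ q \text{ is a prime power and } q\equiv 1 \pmod 4\}. \] Then \[ \rho_{C_n}=\begin{cases}\lceil n\rceil_{\mathbb{F}} & \text{if } n\ge 5,\\ 9 & \text{if } n<5.\end{cases} \]
   Context: For a prime power $q\equiv 1\pmod 4$, let $\mathbb{F}_q$ be the finite field of order $q$ and let $(\mathbb{F}_q^* )^2$ be the set of nonzero squares of $\mathbb{F}_q$. The Paley graph $P(q)$ is the simple undirected graph with vertex set $\mathbb{F}_q$ in which $u$ and $v$ are adjacent if and only if $u-v\in(\mathbb{F}_q^* )^2$. The Paley index of a simple graph $G$ is the minimum of all $q\in\mathbb{N}$ (with $q$ a prime power, $q\equiv 1\pmod 4$, so that $P(q)$ is defined) such that $G$ is isomorphic to a (not necessarily induced) subgraph of $P(q)$. *)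

(* Defs.v *)
From mathcomp Require Import all_boot all_fingroup all_algebra all_field.

Set Implicit Arguments.
Unset Strict Implicit.
Unset Printing Implicit Defensive.

Import GRing.Theory.

Record sgraph := SGraph {
  vert :> finType;
  adj : rel vert;
  adj_sym : symmetric adj;
  adj_irrefl : irreflexive adj }.

Definition graph_iso (G H : sgraph) : Prop :=
  exists2 f : G -> H, bijective f & forall u v, adj (f u) (f v) = adj u v.

Record subgraph (H : sgraph) := Subgraph {
  sub_vert : {set H};
  sub_adj : rel H;
  sub_adj_sym : symmetric sub_adj;
  sub_adjP : forall x y, sub_adj x y ->
    [&& x \in sub_vert, y \in sub_vert & adj x y] }.

Lemma subgraph_adj_sym (H : sgraph) (S : subgraph H) :
  symmetric (relpre (val : {x | x \in sub_vert S} -> H) (@sub_adj H S)).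
Proof. by move=> x y /=; rewrite sub_adj_sym. Qed.

Lemma subgraph_adj_irrefl (H : sgraph) (S : subgraph H) :
  irreflexive (relpre (val : {x | x \in sub_vert S} -> H) (@sub_adj H S)).
Proof.
by move=> x /=; apply/negP => /sub_adjP /and3P[_ _]; rewrite adj_irrefl.
Qed.

Definition sgraph_of_subgraph (H : sgraph) (S : subgraph H) : sgraph :=
  SGraph (@subgraph_adj_sym H S) (@subgraph_adj_irrefl H S).
Coercion sgraph_of_subgraph : subgraph >-> sgraph.

Definition iso_to_subgraph (G H : sgraph) : Prop :=
  exists S : subgraph H, graph_iso G S.

Lemma iso_to_subgraphP (G H : sgraph) :
  iso_to_subgraph G H <->
  exists2 f : G -> H, injective f & forall u v, adj u v -> adj (f u) (f v).
Proof.
split=> [[S [f bij_f adj_f]] | [f inj_f adj_f]].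
  exists (fun u => val (f u)); first by apply: inj_comp val_inj (bij_inj bij_f).
  by move=> u v; rewrite -adj_f => /sub_adjP /and3P[].
pose r x y := [exists u, exists v, [&& f u == x, f v == y & adj u v]].
have r_sym : symmetric r.
  have sub x y : r x y -> r y x.
    case/existsP=> u /existsP[v /and3P[xu yv uv]].
    by apply/existsP; exists v; apply/existsP; exists u; rewrite xu yv adj_sym uv.
  by move=> x y; apply/idP/idP; apply: sub.
have rP x y : r x y -> [&& x \in f @: G, y \in f @: G & adj x y].
  case/existsP=> u /existsP[v /and3P[/eqP<- /eqP<- uv]].
  by rewrite !imset_f ?adj_f.
have fG u : f u \in f @: G by apply: imset_f.
exists (Subgraph r_sym rP); exists (fun u => exist _ (f u) (fG u)).
  have inj_g : injective (fun u => exist (fun x => x \in f @: G) (f u) (fG u)).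
    by move=> u v [] /inj_f.
  by apply: (inj_card_bij inj_g); rewrite card_sig card_imset.
move=> u v; apply/idP/idP => [/existsP[u' /existsP[v' /=]] | uv].
  by case/and3P=> /eqP/inj_f-> /eqP/inj_f->.
by apply/existsP; exists u; apply/existsP; exists v; rewrite /= !eqxx.
Qed.

(* The clause i != j only matters for n = 1, where ordS is the identity. *)
Definition cycle_adj (n : nat) : rel 'I_n :=
  fun i j => (i != j) && ((j == ordS i) || (i == ordS j)).

Lemma cycle_adj_sym (n : nat) : symmetric (@cycle_adj n).
Proof. by move=> i j; rewrite /cycle_adj eq_sym orbC. Qed.

Lemma cycle_adj_irrefl (n : nat) : irreflexive (@cycle_adj n).
Proof. by move=> i; rewrite /cycle_adj eqxx. Qed.

Definition cycle_graph (n : nat) : sgraph :=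
  SGraph (@cycle_adj_sym n) (@cycle_adj_irrefl n).

Definition nonzero_squares (F : finFieldType) : {set F} :=
  [set (x ^+ 2)%R | x : F & x != 0%R].

Lemma neg1_square (F : finFieldType) :
  #|F| = 1 %[mod 4] -> exists i : F, (i ^+ 2 = -1)%R.
Proof.
move=> F1; pose m := #|F| %/ 4.
have cF : #|F| = (4 * m).+1 by rewrite {1}(divn_eq #|F| 4) F1 addn1 mulnC.
have m_gt0 : 0 < m by have := finNzRing_gt1 F; rewrite cF; case: (m).
have [y y0 Py] : exists2 y : F, (y != 0)%R & (y ^+ (2 * m) != 1)%R.
  apply/exists_inP; apply: contraT; rewrite negb_exists_in => /forall_inP Fall.
  have szP : size ('X^(2 * m) - 1 : {poly F})%R = (2 * m).+1.
    by rewrite size_XnsubC // muln_gt0.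
  have nzP : ('X^(2 * m) - 1 : {poly F})%R != 0%R by rewrite -size_poly_eq0 szP.
  have := @max_poly_roots _ _ (enum [pred y : F | y != 0%R]) nzP _ (enum_uniq _).
  rewrite szP -cardE cardC1 cF => rts.
  suff : 4 * m < (2 * m).+1 by rewrite ltnS leq_pmul2r.
  apply: rts; apply/allP => y; rewrite mem_enum => /Fall.
  by rewrite negbK /root !hornerE => /eqP->; rewrite subrr.
have y4 : ((y ^+ (2 * m)) ^+ 2 = 1)%R.
  apply: (mulIf y0); rewrite -exprM -exprSr mul1r mulnAC -cF; exact: expf_card.
move/eqP: y4; rewrite sqrf_eq1 (negPf Py) => /eqP y4.
by exists (y ^+ m)%R; rewrite -exprM mulnC.
Qed.

Definition paley_adj (F : finFieldType) : rel F :=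
  fun u v => (u - v)%R \in nonzero_squares F.

Lemma paley_adj_sym (F : finFieldType) :
  #|F| = 1 %[mod 4] -> symmetric (@paley_adj F).
Proof.
case/neg1_square=> i i2.
have i0 : i != 0%R.
  by apply: contra_eq_neq i2 => ->; rewrite expr0n eq_sym oppr_eq0 oner_eq0.
have sub u v : @paley_adj F u v -> paley_adj v u.
  case/imsetP=> x; rewrite inE => x0 uv; apply/imsetP; exists (i * x)%R.
    by rewrite inE mulf_neq0.
  by rewrite exprMn i2 mulN1r -uv opprB.
by move=> u v; apply/idP/idP; apply: sub.
Qed.

Lemma paley_adj_irrefl (F : finFieldType) : irreflexive (@paley_adj F).
Proof.
move=> u; apply/negP => /imsetP[x]; rewrite inE subrr => x0 /esym/eqP.
by rewrite sqrf_eq0 (negPf x0).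
Qed.

Definition paley_graph (F : finFieldType) (F1 : #|F| = 1 %[mod 4]) : sgraph :=
  SGraph (paley_adj_sym F1) (@paley_adj_irrefl F).

Definition prime_power (q : nat) : bool :=
  [exists p : 'I_q.+1, exists k : 'I_q.+1, [&& prime p, 0 < k & q == p ^ k]].

Lemma prime_powerP (q : nat) :
  reflect (exists p k, [/\ prime p, 0 < k & q = p ^ k]) (prime_power q).
Proof.
apply: (iffP existsP) => [[p /existsP[k /and3P[pp k0 /eqP qE]]] | [p [k [pp k0 qE]]]].
  by exists p, k.
have pq : p < q.+1 by rewrite ltnS qE -{1}[p]expn1 leq_exp2l // prime_gt1.
have kq : k < q.+1 by rewrite ltnS qE ltnW // ltn_expl // prime_gt1.
by exists (Ordinal pq); apply/existsP; exists (Ordinal kq); rewrite /= pp k0 qE eqxx.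
Qed.

Definition paley_order (q : nat) : bool :=
  prime_power q && (q == 1 %[mod 4]).

(* P(q) is realised by any field of order q, since such a field is unique up
   to isomorphism. *)
Definition embeds_in_paley (G : sgraph) (q : nat) : Prop :=
  exists (F : finFieldType) (F1 : #|F| = 1 %[mod 4]),
    #|F| = q /\ iso_to_subgraph G (paley_graph F1).

Definition is_min (P : nat -> Prop) (m : nat) : Prop :=
  P m /\ forall k, P k -> m <= k.

Definition is_paley_index (G : sgraph) : nat -> Prop :=
  is_min (fun q => paley_order q /\ embeds_in_paley G q).

Lemma ceilF_subproof (n : nat) : exists q, (n <= q) && paley_order q.
Proof.
exists (5 ^ n.+1); rewrite ltnW; last by apply: ltn_trans (ltnSn n) (ltn_expl _ _).
rewrite andTb; apply/andP; split; first by apply/prime_powerP; exists 5, n.+1.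
by rewrite -modnXm exp1n.
Qed.

Definition ceilF (n : nat) : nat := ex_minn (ceilF_subproof n).

(* Main.v *)
Require Import Defs.
From mathcomp Require Import all_boot all_fingroup all_algebra all_field.
From mathcomp Require Import zify ring.

(** A cycle on n vertices in P(q) forces n <= q, and P(5), being a 5-cycle,
    has neither a triangle nor a 4-cycle; the next order is 9.  The content is
    therefore the converse: P(q) has cycles of every length from 3 to q as soon
    as q > 5 ([paley_pancyclic]).  Write p for the characteristic and S for
    the set of nonzero squares; S = - S, and u is adjacent to u + s for every
    s in S, so P(q) is a Cayley graph and each translation is an automorphism.

    Lengths from p to q ([has_cycle_ge_pchar]).  The prime subfield carries
    the cycle 0, 1, ..., p - 1.  Suppose that an additive subgroup V has a
    Hamiltonian cycle X.  If V is not the whole field, some s in S lies outside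
    V, because every element is a difference of two squares.  The p cosets
    V + js are joined in succession by the edges u -- u + s, so that
    V + F_p s contains a prism over X for each pair of successive cosets.
    Going up through the prisms one coset at a time, a cycle through all the
    cosets reached so far can be lengthened by any number up to |X| by means of
    the next one: by an even number by zigzagging between the two copies of X
    ([braid_cycle]), by an odd number by going around the new copy of X, which
    changes the parity because |X| is odd ([detour_cycle]).  This reaches a
    Hamiltonian cycle of the larger subgroup, and the argument is repeated.

    Lengths from 3 to p ([has_cycle_le_pchar]).  Since q > 5 there is a
    triangle: h and h + 1 both in S.  If h is not in the prime subfield, the
    two paths 0, 1, 2, ... and h, h + 1, h + 2, ... form a ladder whose rungs
    close up cycles of all lengths up to p, the odd ones thanks to the triangle
    ([ladder_cycle]).  If h = b is in the prime subfield one may take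
    0 < b < p / 2 (replace h by - 1 - h); then integers below p are adjacent
    when they differ by 1, b or b + 1, the ladder still gives the lengths up
    to b + 1, and the graph on {0, ..., n - 1} with these three differences is
    Hamiltonian for every n >= b + 2 ([strip_hamiltonian]). *)

Set Implicit Arguments.
Unset Strict Implicit.
Unset Printing Implicit Defensive.

Import GRing.Theory.

(** * Cycles in prisms *)

Definition has_cycle (T : eqType) (e : rel T) (n : nat) : Prop :=
  exists2 s : seq T, ucycle e s & size s = n.

Section Prism.

Variables (T : eqType) (e : rel T) (f : T -> T).
Hypothesis e_sym : symmetric e.
Hypothesis f_inj : injective f.
Hypothesis f_mono : {mono f : x y / e x y}.
Hypothesis f_adj : forall x, e x (f x).

(** The zigzag x0, f x0, f x1, x1, x2, f x2, f x3, x3, ... over the first k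
    pairs of s: it keeps both ends of s, so it can replace s inside a cycle. *)
Fixpoint braid (k : nat) (s : seq T) : seq T :=
  match k, s with
  | k'.+1, [:: x, y & s'] => [:: x, f x, f y, y & braid k' s']
  | _, _ => s
  end.

Lemma size_braid k s : k.*2 <= size s -> size (braid k s) = size s + k.*2.
Proof.
elim: k s => [|k IHk] s; first by rewrite addn0.
by case: s => [|x [|y s]] //= ks; rewrite IHk; lia.
Qed.

Lemma last_braid k z s : last z (braid k s) = last z s.
Proof. by elim: k z s => // k IHk z [|x [|y s]] //=. Qed.

Lemma path_braid k z s : path e z s -> path e z (braid k s).
Proof.
elim: k z s => // k IHk z [|x [|y s]] //= /and3P[-> xy /IHk->].
by rewrite f_adj f_mono xy e_sym f_adj.
Qed.

Lemma perm_braid k s :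
  k.*2 <= size s -> perm_eq (braid k s) (s ++ map f (take k.*2 s)).
Proof.
elim: k s => [|k IHk] s; first by rewrite take0 cats0.
case: s => [|x [|y s]] //= ks; rewrite perm_cons.
pose t := s ++ map f (take k.*2 s).
rewrite (perm_trans _ (_ : perm_eq [:: f x, f y, y & t] _)) //.
  by rewrite !perm_cons IHk //; lia.
by apply/seq.permP => a; rewrite /t /= !count_cat /=; lia.
Qed.

Lemma braid_cycle k X R :
    k.*2 <= size X ->
  ucycle e (X ++ R) -> uniq (X ++ R ++ map f X) -> ucycle e (braid k X ++ R).
Proof.
move=> leX /andP[cXR _] uXRY; apply/andP; split; last first.
  rewrite (perm_uniq (_ : perm_eq _ (X ++ R ++ map f (take k.*2 X)))).
    apply: subseq_uniq uXRY; rewrite !cat_subseq //.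
    by rewrite map_subseq // take_subseq.
  rewrite (perm_trans (perm_cat (perm_braid leX) (perm_refl R))) //.
  by rewrite -catA perm_cat2l perm_catC.
case: X cXR {leX uXRY} => [|x X] cXR; first by case: k.
move: cXR; rewrite !(cycle_path x) !cat_path !last_cat !last_braid.
by case/andP=> /(path_braid k) -> ->.
Qed.

(** Up at x, backwards around the upper copy of the cycle x, A, B to the first
    vertex of B, and down again.  Compared with x, A, B this trades |A|
    vertices for 1 + |B| new ones, a difference of the parity of the length of
    the cycle. *)
Lemma detour_cycle x A B R :
    B != [::] -> ucycle e (x :: A ++ B) -> ucycle e (x :: A ++ B ++ R) ->
    uniq (x :: A ++ B ++ R ++ map f (x :: A ++ B)) ->
  ucycle e (x :: f x :: rev (map f B) ++ B ++ R).
Proof.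
case: B => // y B _ /andP[cX _] /andP[cXR _] u; apply/andP; split; last first.
  pose t := x :: (y :: B) ++ R ++ map f (x :: y :: B).
  rewrite (perm_uniq (_ : perm_eq _ t)) /t.
    apply: subseq_uniq u; rewrite -cat1s -[in X in subseq _ X]cat1s.
    rewrite cat_subseq //; apply: subseq_trans (suffix_subseq A _).
    do 2!rewrite cat_subseq //; apply: map_subseq.
    by rewrite -cat1s -[in X in subseq _ X]cat1s cat_subseq // suffix_subseq.
  rewrite perm_cons; apply/seq.permP => a.
  by rewrite /= !count_cat /= !count_cat count_rev /=; lia.
move: cX cXR; rewrite /path.cycle !rcons_cat /= !rcons_cat !cat_path /=.
case/and3P=> _ _ yBx /and3P[_ _]; rewrite -rcons_cat => ->.
rewrite f_adj rev_cons last_rcons e_sym f_adj !andbT.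
have := rev_path e (f y) (map f (rcons B x)).
rewrite map_rcons last_rcons belast_rcons rev_cons -map_rcons path_map => ->.
by rewrite (eq_path (e' := e)) // => u' v /=; rewrite f_mono e_sym.
Qed.

(** For a cycle X of odd length m, the braids supply the even gains up to
    m - 1 and the detours the odd gains 1 + |B| - |A| = 2 + 2|B| - m. *)
Lemma prism_cycle_extend X R n :
    odd (size X) -> 1 < size X -> ucycle e X -> ucycle e (X ++ R) ->
    uniq (X ++ R ++ map f X) ->
    size (X ++ R) <= n <= size (X ++ R) + size X ->
  has_cycle e n.
Proof.
move=> oX X1 cX cXR u /andP[le_n n_le]; rewrite size_cat in le_n n_le.
have [t [nE t_le]] : exists t, n = size X + size R + t /\ t <= size X.
  by exists (n - (size X + size R)); lia.
have [ot|et] := boolP (odd t); last first.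
  exists (braid t./2 X ++ R); first by apply: braid_cycle => //; lia.
  by rewrite size_cat size_braid; lia.
case: X oX X1 cX cXR u le_n n_le nE t_le => //= x X oX X1 cX cXR u _ _ nE t_le.
(* The detour gains t vertices when 2 + 2 * size B = (size X).+1 + t. *)
pose a := size X - ((size X).+1 + t)./2.-1.
have szB : size (drop a X) = ((size X).+1 + t)./2.-1.
  by rewrite size_drop /a; lia.
exists (x :: f x :: rev (map f (drop a X)) ++ drop a X ++ R); last first.
  by rewrite /= !size_cat size_rev size_map szB; lia.
apply: (@detour_cycle x (take a X)); first by rewrite -size_eq0 szB; lia.
- by rewrite cat_take_drop.
- by rewrite catA cat_take_drop.
- by rewrite catA cat_take_drop.
Qed.

(** The detour with A empty visits all of the upper copy consecutively; the
    rotated form Y ++ Q makes Y ready to serve as the lower cycle of the next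
    prism. *)
Lemma prism_cycle_full X R :
    1 < size X -> ucycle e X -> ucycle e (X ++ R) -> uniq (X ++ R ++ map f X) ->
  exists Y Q, [/\ ucycle e Y, ucycle e (Y ++ Q), perm_eq Y (map f X)
    & perm_eq Q (X ++ R)].
Proof.
case: X => // x X X1 cX cXR u.
exists (f x :: rev (map f X)), (X ++ R ++ [:: x]); split.
- have ->: f x :: rev (map f X) = rotr 1 (rev (map f (x :: X))).
    by rewrite /= rev_cons rotr1_rcons.
  rewrite rotr_ucycle /ucycle rev_uniq (map_inj_uniq f_inj) rev_cycle.
  rewrite (eq_cycle (e' := e)); last by move=> ? ?; rewrite e_sym.
  by rewrite (mono_cycle f_mono).
- rewrite -(rotr_ucycle 1) 2!catA -(cat_rcons x) cats0.
  rewrite rotr1_rcons -catA; apply: (@detour_cycle x [::]) => //.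
  by case: (X) X1.
- by rewrite /= perm_cons perm_rev.
- by rewrite catA cats1 perm_rcons.
Qed.

End Prism.
(** * Hamiltonian cycles in strips *)

Definition strip (b : nat) : rel nat :=
  fun i j => let d := (i - j) + (j - i) in [|| d == 1, d == b | d == b.+1].

Lemma strip_sym b : symmetric (strip b).
Proof. by move=> i j; rewrite /strip addnC. Qed.

(** The cycle is normalised to start with the run m, ..., m + l - 1, because
    it is between two consecutive members of that run that the next vertex,
    m + b.+1, is going to be inserted. *)
Definition strip_ham (b m l : nat) : Prop :=
  exists2 R, ucycle (strip b) (iota m l ++ R)
    & perm_eq (iota m l ++ R) (iota 0 (m + b.+1)).

Lemma path_iota b i k : path (strip b) i (iota i.+1 k).
Proof. by elim: k i => //= k IHk i; rewrite IHk andbT /strip; lia. Qed.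

Lemma last_iota i k : last i (iota i.+1 k) = i + k.
Proof. by elim: k i => [|k IHk] i; rewrite ?addn0 //= IHk addSnnS. Qed.

Lemma strip_ham_base b : 0 < b -> strip_ham b 1 b.+1.
Proof.
move=> b0; exists [:: 0]; last by rewrite perm_catC addSn.
have u : uniq (iota 1 b.+1 ++ [:: 0]).
  by rewrite (perm_uniq (_ : perm_eq _ (iota 0 b.+2))) ?iota_uniq // perm_catC.
rewrite -(rotr_ucycle 1) cats1 rotr1_rcons -[0 :: _]/(iota 0 b.+2).
rewrite /ucycle iota_uniq andbT /= rcons_path.
rewrite -/(iota 1 b.+1) path_iota.
by rewrite -[last _ _]/(last 0 (iota 1 b.+1)) last_iota /strip; lia.
Qed.

(** The new vertex m + b + 1 fits between m and m + 1, at distances b + 1 and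
    b; this uses up the edge from m to m + 1 of the run. *)
Lemma strip_ham_insert1 b m l : strip_ham b m l.+2 -> strip_ham b m.+1 l.+1.
Proof.
case=> R /andP[cR uR] pR.
have pR' : perm_eq (iota m.+1 l.+1 ++ R ++ [:: m; m + b.+1])
                   (iota 0 (m.+1 + b.+1)).
  rewrite addSn -[(m + b.+1).+1]addn1 iotaD add0n.
  rewrite (perm_trans _ (perm_cat pR (perm_refl _))) //.
  by apply/seq.permP => a; rewrite !count_cat /= ?count_cat /=; lia.
exists (R ++ [:: m; m + b.+1]) => //.
apply/andP; split; last by rewrite (perm_uniq pR') iota_uniq.
move: cR; rewrite /= !rcons_path !cat_path !last_cat /=.
case/and3P=> _ /andP[-> ->] ->.
by rewrite /= /strip; lia.
Qed.

Lemma path_rev_iota b n k : path (strip b) (n + k) (rev (iota n k)).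
Proof.
elim: k => // k IHk; rewrite -addn1 iotaD /= cats1 rev_rcons /= IHk andbT.
by rewrite /strip; lia.
Qed.

(** Insertions one by one exhaust the run after b steps.  To renew it, the
    whole block m + b + 1, ..., m + 2b is inserted, reversed, into the edge
    between m + b - 1 and m + b: its two end vertices are at distance b + 1
    and 1 from them. *)
Lemma strip_ham_row b m :
  0 < b -> strip_ham b m b.+1 -> strip_ham b (m + b) b.+1.
Proof.
move=> b0 [R /andP[cR uR] pR].
pose s := iota m b ++ rev (iota (m + b) b.+1) ++ R.
have pS : perm_eq s (iota 0 (m + b + b.+1)).
  rewrite (_ : m + b + b.+1 = m + b.+1 + b); last by lia.
  rewrite iotaD add0n.
  rewrite (perm_trans _ (perm_cat pR (perm_refl _))) //.
  apply/seq.permP => a; rewrite !count_cat count_rev.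
  have ->: count a (iota m b.+1) = count a (iota m b) + a (m + b).
    by rewrite -addn1 iotaD count_cat /= addn0.
  by rewrite /= addnS; lia.
have cS : ucycle (strip b) s.
  apply/andP; split; last by rewrite (perm_uniq pS) iota_uniq.
  rewrite /s -addn1 [iota (m + b) _]iotaD cats1 rev_rcons.
  case: b b0 cR {s uR pR pS} => // b _.
  rewrite -[b.+2]addn1 iotaD /= -catA /= !rcons_path !cat_path !last_cat /=.
  rewrite !last_cat /= cat_path.
  rewrite last_iota -!andbA => /and4P[-> _ cR cRm].
  have:= path_rev_iota b.+1 (m + b.+1) b.+1; rewrite /= => ->.
  by rewrite rev_cons !last_rcons cR cRm !andbT /= /strip; lia.
exists (rev (iota m b) ++ rev R).
  rewrite catA -rot_size_cat rot_ucycle -[iota (m + b) _]revK -!rev_cat -catA.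
  rewrite /ucycle rev_uniq rev_cycle (eq_cycle (e' := strip b)) //.
  by move=> i j; apply: strip_sym.
rewrite -(permPr pS) /s; apply/seq.permP => a.
by rewrite !count_cat !count_rev; lia.
Qed.

(** Here n = (k * b + t) + b + 2 with t < b: k blocks, and then t single
    vertices. *)
Lemma strip_hamiltonian b n :
    0 < b -> b.+2 <= n ->
  exists2 s, ucycle (strip b) s & perm_eq s (iota 0 n).
Proof.
move=> b0 n_ge.
have rows k : strip_ham b (k * b).+1 b.+1.
  elim: k => [|k IHk]; first exact: strip_ham_base.
  by rewrite mulSnr -addSn; apply: strip_ham_row.
have part m t : t <= b -> strip_ham b m b.+1 -> strip_ham b (m + t) (b - t).+1.
  move=> + h; elim: t => [|t IHt] t_le; first by rewrite addn0 subn0.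
  rewrite addnS; apply: strip_ham_insert1.
  by rewrite -subnSK // in IHt; apply: IHt; apply: ltnW.
have [|R cR pR] := part _ ((n - b.+2) %% b) _ (rows ((n - b.+2) %/ b)).
  by rewrite ltnW // ltn_mod.
eexists; first exact: cR.
by rewrite (permPl pR) addSn addSnnS -divn_eq subnK.
Qed.
(** * Lengths from the characteristic upwards *)

Section PaleyCycles.

Local Open Scope ring_scope.

Variable F : finFieldType.
Hypothesis F1 : (#|F| = 1 %[mod 4])%N.

Notation S := (nonzero_squares F).
Notation E := (@paley_adj F).

Let E_sym : symmetric E := paley_adj_sym F1.

Lemma paley_adjD (d : F) : {mono +%R^~ d : u v / E u v}.
Proof. by move=> u v; rewrite /paley_adj opprD addrACA subrr addr0. Qed.

Lemma paley_adj_step (u s : F) : s \in S -> E u (u + s).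
Proof. by rewrite E_sym /paley_adj addrAC subrr add0r. Qed.

Lemma nonzero_squaresN (s : F) : s \in S -> - s \in S.
Proof.
by have:= E_sym 0 s; rewrite /paley_adj subr0 sub0r => ->.
Qed.

Lemma nonzero_squaresX2 (x : F) : x != 0 -> x ^+ 2 \in S.
Proof. by move=> x0; apply/imsetP; exists x; rewrite ?inE. Qed.

Lemma nonzero_squares1 : 1 \in S.
Proof. by rewrite -(expr1n F 2) nonzero_squaresX2 ?oner_eq0. Qed.

(** Translation by 1 permutes the field, hence preserves the sum of all its
    elements while adding #|F| ones to it. *)
Lemma natr_card_finField : #|F|%:R = 0 :> F.
Proof.
have: \sum_(x : F) x = \sum_(x : F) (x + 1) by apply: reindex_inj (addIr 1).
by rewrite big_split /= sumr_const -[LHS]addr0 => /addrI <-.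
Qed.

Lemma mem0_sub_closed (X : seq F) :
  (1 < size X)%N -> {in X &, forall x y, x - y \in X} -> 0 \in X.
Proof.
case: X => // x X _ /(_ x x (mem_head _ _) (mem_head _ _)).
by rewrite subrr.
Qed.

Section Characteristic.

Variable p : nat.
Hypothesis pF : p \in [pchar F].

Lemma pchar_dvd_card : (p %| #|F|)%N.
Proof. by rewrite (dvdn_pcharf pF) natr_card_finField. Qed.

Lemma odd_pchar : odd p.
Proof.
apply: dvdn_odd pchar_dvd_card _.
by rewrite (divn_eq #|F| 4) F1 addn1 /= oddM andbF.
Qed.

Lemma two_neq0 : 2%:R != 0 :> F.
Proof.
rewrite -(dvdn_pcharf pF) dvdn_prime2 ?(pcharf_prime pF) //.
by apply/eqP => p2; have := odd_pchar; rewrite p2.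
Qed.

Lemma natr_inj_lt (i j : nat) :
  (i < p)%N -> (j < p)%N -> i%:R = j%:R :> F -> i = j.
Proof.
wlog ij : i j / (i <= j)%N => [wlog_ij|] ip jp ijE.
  by case: (leqP i j) => [|/ltnW] /wlog_ij h; rewrite h.
have: (p %| j - i)%N by rewrite (dvdn_pcharf pF) natrB // ijE subrr.
by case: (posnP (j - i)) => [|/dvdn_leq h /h]; lia.
Qed.

(** X runs through an additive subgroup V.  The cosets V + js for j < p are
    disjoint since s has order p modulo V; they are added one at a time, each
    being the upper copy in a prism over the previous one. *)
Lemma subgroup_row_step (X : seq F) (s : F) :
    (1 < size X)%N -> {in X &, forall x y, x - y \in X} ->
    odd (size X) -> ucycle E X -> s \in S -> s \notin X ->
  exists Z, [/\ ucycle E Z, size Z = (p * size X)%N,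
    {in Z &, forall x y, x - y \in Z}
    & forall n, (size X <= n <= size Z)%N -> has_cycle E n].
Proof.
move=> X1 subX oX cX Ss sX.
have p_gt1 : (1 < p)%N := prime_gt1 (pcharf_prime pF).
have X0 := mem0_sub_closed X1 subX.
have addX : {in X &, forall x y, x + y \in X}.
  by move=> x y Xx Xy; rewrite -[y]opprK subX // -sub0r subX.
have X_mul k x : x \in X -> x *+ k \in X.
  by move=> Xx; elim: k => [|k IHk]; rewrite ?mulr0n // mulrS addX.
have X_ms k : (0 < k < p)%N -> s *+ k \notin X.
  (* k is invertible modulo p, so s is a multiple of s *+ k. *)
  move=> kp; apply: contra sX => /(X_mul (egcdn k p).1).
  rewrite -mulrnA.
  case: egcdnP => [|u v uE _] /=; first lia.
  have /eqP gcd1 : coprime k p.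
    rewrite coprime_sym prime_coprime ?(pcharf_prime pF) //.
    by apply/negP => /dvdn_leq; lia.
  rewrite mulnC uE gcd1 mulrnDr mulnC mulrnA -[s *+ p]mulr_natr (pcharf0 pF).
  by rewrite mulr0 mul0rn add0r.
have rows j : (j < p)%N -> exists Y R,
   [/\ ucycle E Y, ucycle E (Y ++ R), size Y = size X
     & size (Y ++ R) = (j.+1 * size X)%N] /\
   [/\ Y =i [pred z | z - s *+ j \in X],
     forall z, z \in Y ++ R <-> exists2 i, (i <= j)%N & z - s *+ i \in X
     & forall n, (size X <= n <= j.+1 * size X)%N -> has_cycle E n].
  elim: j => [|j IHj] jp.
    exists X, [::]; rewrite cats0 mul1n; split; split => //.
    - by move=> z; rewrite inE mulr0n subr0.
    - move=> z; split=> [Xz|[i]]; first by exists 0; rewrite ?mulr0n ?subr0.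
      by rewrite leqn0 => /eqP->; rewrite mulr0n subr0.
    - by move=> n nX; exists X => //; apply/eqP; rewrite eqn_leq.
  have [Y [R [[cY cYR szY szYR] [YE YRE lenYR]]]] := IHj (ltnW jp).
  have u : uniq (Y ++ R ++ map (+%R^~ s) Y).
    rewrite catA cat_uniq (map_inj_uniq (addIr s)).
    case/andP: cYR => _ ->; case/andP: cY => _ ->; rewrite andbT /=.
    apply/hasPn => _ /mapP[y Yy ->]; apply/negP => /YRE[i ij Xi].
    move: Yy; rewrite YE inE => Xy.
    have := subX _ _ Xi Xy.
    have -> : y + s - s *+ i - (y - s *+ j) = s *+ (j.+1 - i).
      by rewrite mulrnBr ?mulrS; [ring | lia].
    by apply/negP/X_ms; lia.
  have [|||||Y' [R' [cY' cYR' pY pR]]] :=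
    @prism_cycle_full _ E _ E_sym (addIr s) (paley_adjD s) _ Y R => //.
  - by move=> x; apply: paley_adj_step.
  - by rewrite szY.
  exists Y', R'; split; split => //.
  - by rewrite (perm_size pY) size_map.
  - by rewrite size_cat (perm_size pY) (perm_size pR) size_map szY szYR mulSn.
  - move=> z; rewrite (perm_mem pY) inE.
    apply/mapP/idP => [[y Yy ->]|Xz].
      by move: Yy; rewrite YE inE mulrS opprD addrA addrK.
    by exists (z - s); rewrite ?subrK // YE inE -addrA -opprD -mulrS.
  - move=> z; rewrite mem_cat (perm_mem pY) (perm_mem pR).
    split=> [/orP[/mapP[y Yy ->]|/YRE[i ij Xi]]|[i]].
    + by exists j.+1 => //; move: Yy; rewrite YE inE mulrS opprD addrA addrK.
    + by exists i => //; apply: leqW.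
    rewrite leq_eqVlt => /orP[/eqP->|ij] Xz.
      apply/orP; left; apply/mapP; exists (z - s); rewrite ?subrK //.
      by rewrite YE inE -addrA -opprD -mulrS.
    by apply/orP; right; apply/YRE; exists i.
  move=> n /andP[Xn]; case: (leqP n (j.+1 * size X)) => [nj _|jn nj].
    by apply: lenYR; rewrite Xn.
  apply: (@prism_cycle_extend _ E (+%R^~ s) E_sym (paley_adjD s) _ Y R) => //.
  - by move=> x; apply: paley_adj_step.
  - by rewrite szY.
  - by rewrite szY.
  - by rewrite szYR szY; lia.
have [|Y [R [[_ cZ _ szZ] [_ ZE lenZ]]]] := rows p.-1.
  by rewrite ltn_predL; lia.
rewrite prednK in szZ lenZ; last lia.
exists (Y ++ R); split=> //; last by move=> n; rewrite szZ; apply: lenZ.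
move=> x y /ZE[i ip Xi] /ZE[j jp Xj]; apply/ZE.
have E1 := subX _ _ Xi Xj.
have sp : s *+ p = 0 by rewrite -mulr_natr (pcharf0 pF) mulr0.
case: (leqP j i) => ij.
  exists (i - j)%N; first lia.
  rewrite mulrnBr //.
  by have -> : x - y - (s *+ i - s *+ j) = x - s *+ i - (y - s *+ j) by ring.
exists (p + i - j)%N; first lia.
rewrite mulrnBr; last lia.
rewrite mulrnDr sp add0r.
by have -> : x - y - (s *+ i - s *+ j) = x - s *+ i - (y - s *+ j) by ring.
Qed.
Lemma has_cycle_subgroup (X : seq F) (n : nat) :
    (1 < size X)%N -> {in X &, forall x y, x - y \in X} ->
    odd (size X) -> ucycle E X -> (size X <= n <= #|F|)%N ->
  has_cycle E n.
Proof.
have [m] := ubnP (#|F| - size X); elim: m X => // m IHm X le_m X1 subX oX cX nX.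
have p_gt1 : (1 < p)%N := prime_gt1 (pcharf_prime pF).
have uX : uniq X by case/andP: cX.
have X0 := mem0_sub_closed X1 subX.
have [s /andP[/= Ss sX] | SX] := pickP [pred s in S | s \notin X]; last first.
  (* The identity z = ((z + 1) / 2) ^ 2 - ((z - 1) / 2) ^ 2 shows that a
     subgroup containing all squares is everything. *)
  have two_neq0 := two_neq0.
  have sqX x : x ^+ 2 \in X.
    have [->|x0] := eqVneq x 0; first by rewrite expr0n.
    by have := SX (x ^+ 2); rewrite /= nonzero_squaresX2 //= => /negbFE.
  have leF : (#|F| <= size X)%N.
    rewrite cardE; apply: uniq_leq_size (enum_uniq _) _ => z _.
    have -> : z = ((z + 1) / 2%:R) ^+ 2 - ((z - 1) / 2%:R) ^+ 2 by field.
    exact: subX.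
  case/andP: nX => Xn nF; exists X => //; apply/eqP.
  by rewrite eqn_leq Xn (leq_trans nF leF).
have [Z [cZ szZ subZ lenZ]] := subgroup_row_step X1 subX oX cX Ss sX.
have [leZ|ltZ] := leqP n (size Z); first by apply: lenZ; case/andP: nX => ->.
case/andP: nX => Xn nF; apply: (IHm Z) => //; last by rewrite ltnW.
- by rewrite szZ; nia.
- by rewrite szZ; nia.
- by rewrite szZ oddM odd_pchar.
Qed.

Lemma natr_modp (m : nat) : (m %% p)%:R = m%:R :> F.
Proof. by rewrite {2}(divn_eq m p) natrD natrM (pcharf0 pF) mulr0 add0r. Qed.

Lemma path_natr (a k : nat) : path E a%:R (map (GRing.natmul 1) (iota a.+1 k)).
Proof.
elim: k a => //= k IHk a; rewrite IHk andbT.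
by rewrite -natr1 paley_adj_step ?nonzero_squares1.
Qed.

Lemma has_cycle_ge_pchar (n : nat) : (p <= n <= #|F|)%N -> has_cycle E n.
Proof.
have p_gt1 : (1 < p)%N := prime_gt1 (pcharf_prime pF).
pose X := map (GRing.natmul (1 : F)) (iota 0 p).
have szX : size X = p by rewrite size_map size_iota.
rewrite -{1}szX; apply: has_cycle_subgroup; rewrite ?szX ?odd_pchar //.
  move=> _ _ /mapP[i] + -> /mapP[j] + ->; rewrite !mem_iota => ip jp.
  apply/mapP; exists ((i + (p - j)) %% p)%N.
    by rewrite mem_iota ltn_mod; lia.
  have p0 := pcharf0 pF; apply: (addIr (j%:R : F)); rewrite subrK.
  rewrite natr_modp.
  by rewrite -natrD -addnA subnK ?natrD ?p0 ?addr0 //; lia.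
rewrite /ucycle map_inj_in_uniq ?iota_uniq ?andbT; last first.
  by move=> a b; rewrite !mem_iota => ai bi; apply: natr_inj_lt; lia.
have p0 := pcharf0 pF; rewrite /X -(ltn_predK p_gt1) in p0 *.
rewrite /= rcons_path path_natr last_map last_iota add0n.
have -> : 0%:R = (p.-1)%:R + 1 :> F by rewrite natr1 p0.
exact: paley_adj_step nonzero_squares1.
Qed.

(** * Lengths up to the characteristic *)

(** The identity ((t + 1/t) / 2)^2 - ((t - 1/t) / 2)^2 = 1 yields two nonzero
    squares unless t = 0 or t^4 = 1, that is t^5 = t, which has at most five
    solutions. *)
Lemma triangle_exists : (5 < #|F|)%N -> exists2 h : F, h \in S & h + 1 \in S.
Proof.
move=> q5.
have two_neq0 := two_neq0.
have [t t5|t5] := pickP [pred t : F | t ^+ 5 != t]; last first.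
  have szP : size ('X^5 - 'X : {poly F}) = 6.
    by rewrite size_polyDl size_polyXn // size_polyN size_polyX.
  have nzP : ('X^5 - 'X : {poly F}) != 0 by rewrite -size_poly_eq0 szP.
  have := @max_poly_roots _ _ (enum F) nzP _ (enum_uniq _).
  rewrite szP -cardE => rts; suff : (#|F| < 6)%N by lia.
  apply: rts; apply/allP => t _; have /negbFE/eqP t5' := t5 t.
  by rewrite /root !hornerE t5' subrr.
have t0 : t != 0 by apply: contraNneq t5 => /= ->; rewrite expr0n.
have [tm tp] : t ^+ 2 - 1 != 0 /\ t ^+ 2 + 1 != 0.
  apply/andP; rewrite -negb_or -mulf_eq0; apply: contraNneq t5 => /= t4.
  have tE : t ^+ 5 - t = t * ((t ^+ 2 - 1) * (t ^+ 2 + 1)) by ring.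
  by rewrite -subr_eq0 tE t4 mulr0.
exists (((t ^+ 2 - 1) / (2%:R * t)) ^+ 2).
  by rewrite nonzero_squaresX2 // mulf_neq0 ?invr_eq0 ?mulf_neq0.
have -> : ((t ^+ 2 - 1) / (2%:R * t)) ^+ 2 + 1 =
          ((t ^+ 2 + 1) / (2%:R * t)) ^+ 2.
  by field; rewrite t0.
by rewrite nonzero_squaresX2 // mulf_neq0 ?invr_eq0 ?mulf_neq0.
Qed.

(** Up one side of the ladder and down the other.  When j = i the top rung
    has difference h; when j = i + 1 the top edge is the diagonal, of
    difference h + 1. *)
Lemma ladder_cycle (h : F) (i j : nat) :
    h \in S -> h + 1 \in S -> (0 < i)%N -> (i <= j <= i.+1)%N -> (j <= p)%N ->
    (forall a b, (a < i)%N -> (b < j)%N -> h + b%:R != a%:R) ->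
  ucycle E (map (GRing.natmul 1) (iota 0 i)
            ++ rev (map (fun b => h + b%:R) (iota 0 j))).
Proof.
move=> Sh Sh1 i0 /andP[ij ji] jp dis; apply/andP; split; last first.
  rewrite cat_uniq rev_uniq !map_inj_in_uniq ?iota_uniq ?andbT /=.
  - apply/hasPn => x; rewrite mem_rev => /mapP[b]; rewrite mem_iota => bj ->.
    apply/mapP => -[a]; rewrite mem_iota => ai /eqP; apply/negP.
    by apply: dis; lia.
  - move=> a b; rewrite !mem_iota => ai bi /addrI; apply: natr_inj_lt; lia.
  - move=> a b; rewrite !mem_iota => ai bi; apply: natr_inj_lt; lia.
case: i i0 ij ji {dis} => // i _; case: j jp => // j _ ij ji.
pose y b : F := h + b%:R; rewrite -/y.
have path_y k : path E (y k) (rev (map y (iota 0 k))).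
  elim: k => // k IHk; rewrite -addn1 iotaD map_cat rev_cat /= IHk andbT addn1.
  by rewrite E_sym /y -natr1 addrA paley_adj_step ?nonzero_squares1.
have last_y k : last (y k) (rev (map y (iota 0 k))) = y 0%N.
  by case: k => //= k; rewrite rev_cons last_rcons.
rewrite -[j.+1]addn1 iotaD map_cat rev_cat /= rcons_path cat_path path_natr.
rewrite last_cat last_map last_iota /= path_y last_y andbT; apply/andP; split.
  rewrite /y addrC; have [->|->] : j = i \/ j = i.+1 by lia.
    exact: paley_adj_step.
  by rewrite -natr1 -addrA [1 + h]addrC paley_adj_step.
by rewrite E_sym /y addr0 -[h]add0r paley_adj_step.
Qed.

Lemma ladder_has_cycle (h : F) (n : nat) :
    h \in S -> h + 1 \in S -> (3 <= n <= p)%N ->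
    (forall a b, (a < n./2)%N -> (b < uphalf n)%N -> h + b%:R != a%:R) ->
  has_cycle E n.
Proof.
move=> Sh Sh1 n_le dis; eexists.
  by apply: (ladder_cycle Sh Sh1 _ _ _ dis); lia.
by rewrite size_cat size_rev !size_map !size_iota; lia.
Qed.

Lemma zero_not_square : 0 \notin S.
Proof. by have := paley_adj_irrefl (0 : F); rewrite /paley_adj subr0 => ->. Qed.

Lemma strip_has_cycle (b n : nat) :
    (0 < b)%N -> (b.*2 < p)%N -> b%:R \in S -> b.+1%:R \in S ->
    (3 <= n <= p)%N ->
  has_cycle E n.
Proof.
move=> b0 bp Sb Sb1 n_le; have [nb|nb] := leqP n b.+1.
  apply: (@ladder_has_cycle b%:R); rewrite ?natr1 // => a c a_lt c_lt.
  rewrite -natrD; apply/eqP => /natr_inj_lt; lia.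
have [s /andP[cs us] ps] := strip_hamiltonian b0 nb.
have s_lt : all (fun i => i < p)%N s.
  by apply/allP => i; rewrite (perm_mem ps) mem_iota; lia.
exists (map (GRing.natmul 1) s); last first.
  by rewrite size_map (perm_size ps) size_iota.
apply/andP; split; last first.
  rewrite map_inj_in_uniq // => i j /(allP s_lt) ip /(allP s_lt).
  exact: natr_inj_lt.
apply: homo_cycle cs => i j; wlog ij : i j / (i <= j)%N => [wlog_ij|].
  case: (leqP i j) => [|/ltnW] /wlog_ij // h; rewrite strip_sym => /h.
  by rewrite E_sym.
rewrite /strip => ijE; rewrite -(subnKC ij) natrD; apply: paley_adj_step.
have /or3P[] : [|| j - i == 1, j - i == b | j - i == b.+1]%N by lia.
all: by move/eqP->; rewrite ?nonzero_squares1.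
Qed.

(** The pair h, h + 1 may be replaced by - (h + 1), - h, which exchanges the
    residues b and p - 1 - b; one of these is less than p / 2. *)
Lemma has_cycle_le_pchar (n : nat) :
  (5 < #|F|)%N -> (3 <= n <= p)%N -> has_cycle E n.
Proof.
move=> q5 n_le; have [h Sh Sh1] := triangle_exists q5.
have [c /eqP hc|hF] := pickP (fun c : 'I_p => h == c%:R); last first.
  apply: (ladder_has_cycle Sh Sh1) => // a b a_lt b_lt; apply/eqP => hab.
  have p_gt0 : (0 < p)%N by lia.
  have := hF (Ordinal (ltn_pmod (a + (p - b)) p_gt0)).
  move/eqP; apply; rewrite /= natr_modp natrD natrB; last lia.
  by rewrite (pcharf0 pF) sub0r -hab addrK.
have c0 : (0 < c)%N.
  by case: posnP Sh => // c0; rewrite hc c0 (negPf zero_not_square).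
have c1 : (c.+1 < p)%N.
  rewrite ltn_neqAle ltn_ord andbT; apply: contraTneq Sh1 => cp.
  by rewrite hc natr1 cp (pcharf0 pF) zero_not_square.
have [c_le|c_gt] := ltnP c.*2 p.
  by apply: (strip_has_cycle c0) => //; rewrite -?natr1 -hc.
have neg m : (m <= p)%N -> (p - m)%:R = - m%:R :> F.
  by move=> mp; rewrite natrB // (pcharf0 pF) sub0r.
apply: (@strip_has_cycle (p - c.+1)%N) => //; first lia.
- by have := odd_pchar; lia.
- by rewrite neg ?(ltnW c1) // -natr1 -hc nonzero_squaresN.
- by rewrite -subSn // subSS neg ?(ltnW (ltn_ord c)) // -hc nonzero_squaresN.
Qed.

End Characteristic.

Lemma paley_pancyclic (n : nat) :
  (5 < #|F|)%N -> (3 <= n <= #|F|)%N -> has_cycle E n.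
Proof.
move=> q5 n_le; have [p _ pF] := finPcharP F.
have [np|pn] := leqP n p; first by apply: (has_cycle_le_pchar pF); lia.
by apply: (has_cycle_ge_pchar pF); lia.
Qed.

End PaleyCycles.
(** * The field of order five *)

Section OrderFive.

Local Open Scope ring_scope.

Variable F : finFieldType.
Hypothesis F5 : #|F| = 5%N.

Lemma order5_eq0 : 5%:R = 0 :> F.
Proof. by rewrite -F5 natr_card_finField. Qed.

Lemma order5_sqr (s : F) : s \in nonzero_squares F -> s ^+ 2 = 1.
Proof.
case/imsetP=> x; rewrite inE => x0 ->; apply: (mulfI x0).
by rewrite mulr1 -exprM -exprS -F5 expf_card.
Qed.

(** With all squared differences equal to 1, expanding
    (a - c)^2 = ((a - b) + (b - c))^2 gives 2(a - b)(b - c) = - 1, whence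
    4 = 1, impossible modulo 5. *)
Lemma order5_no_triangle (a b c : F) :
  paley_adj a b -> paley_adj b c -> ~~ paley_adj a c.
Proof.
move=> /order5_sqr ab /order5_sqr bc; apply/negP => /order5_sqr ac.
have : (1 : F) = 0; last by apply/eqP; rewrite oner_eq0.
have q : 2%:R * ((a - b) * (b - c)) = - 1.
  have : (a - c) ^+ 2 =
      (a - b) ^+ 2 + (b - c) ^+ 2 + 2%:R * ((a - b) * (b - c)).
    by ring.
  by rewrite ab bc ac => h; apply: (addrI (1 + 1)); rewrite -h addrK.
have : (2%:R * ((a - b) * (b - c))) ^+ 2 = 4%:R by rewrite !exprMn ab bc; ring.
rewrite q sqrrN expr1n => h4.
have -> : (1 : F) = 2%:R * (4%:R - 1) - 5%:R by ring.
by rewrite order5_eq0 -h4; ring.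
Qed.

(** Each edge is a step 1 or - 1, and distinct opposite vertices prevent two
    consecutive steps from cancelling; so all four steps are equal, and 4
    times a nonzero step cannot vanish. *)
Lemma order5_no_square (a b c d : F) :
    paley_adj a b -> paley_adj b c -> paley_adj c d -> a != c -> b != d ->
  ~~ paley_adj d a.
Proof.
move=> /order5_sqr ab /order5_sqr bc /order5_sqr cd ac bd.
apply/negP => /order5_sqr da.
have turn (x y z : F) :
    (x - y) ^+ 2 = 1 -> (y - z) ^+ 2 = 1 -> x != z -> x - y = y - z.
  move=> xy yz xz; apply/eqP; rewrite -subr_eq0.
  have /eqP : (x - y - (y - z)) * (x - z) = (x - y) ^+ 2 - (y - z) ^+ 2 by ring.
  by rewrite xy yz subrr mulf_eq0 [x - z == 0]subr_eq0 (negPf xz) orbF.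
have h1 := turn _ _ _ ab bc ac; have h2 := turn _ _ _ bc cd bd.
have h3 : c - d = d - a by apply: turn => //; rewrite eq_sym.
have d0 : d - a = 0.
  have -> : d - a = 5%:R * (d - a)
     - ((a - b) + (b - c) + (c - d) + (d - a)) by rewrite h1 h2 h3; ring.
  by rewrite order5_eq0; ring.
by move/eqP: da; rewrite d0 expr0n eq_sym oner_eq0.
Qed.

End OrderFive.

(** * The Paley index of a cycle *)

Lemma has_cycle_embeds (G : sgraph) (n : nat) :
  has_cycle (@adj G) n -> iso_to_subgraph (cycle_graph n) G.
Proof.
case=> s /andP[cs us] <-; apply/iso_to_subgraphP.
case: s cs us => [|x s] cs us.
  have no_ord (i : 'I_0) : False by case: i.
  by exists (fun i : 'I_0 => match no_ord i with end) => i; case: (no_ord i).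
have stepE (u v : 'I_(size s).+1) :
    v = ordS u -> adj (nth x (x :: s) u) (nth x (x :: s) v).
  move=> ->; have /(pathP x)/(_ u) := cs.
  rewrite size_rcons ltn_ord => /(_ isT).
  rewrite /= nth_rcons -rcons_cons nth_rcons /= ltn_ord.
  have [us'|] := ltnP u (size s); first by rewrite modn_small.
  rewrite leq_eqVlt => /orP[/eqP us'|]; last by rewrite ltnNge -ltnS ltn_ord.
  by rewrite -us' eqxx modnn.
exists (fun i : 'I_(size s).+1 => nth x (x :: s) i).
  by move=> i j /eqP; rewrite nth_uniq //= => /eqP/val_inj.
move=> u v /andP[_ /orP[/eqP/stepE //|/eqP/stepE]].
by rewrite adj_sym.
Qed.

(** The only order q <= 5 is 5, where the required length is n = 5 = p, so
    that no triangle is needed. *)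
Lemma paley_embeds (q n : nat) :
  paley_order q -> 3 <= n <= q -> 5 <= n \/ 5 < q ->
  embeds_in_paley (cycle_graph n) q.
Proof.
case/andP=> /prime_powerP[p [k [pp k0 qE]]] /eqP q1 nq n5.
have [F pF cF] := pPrimePowerField pp k0.
have F1 : #|F| = 1 %[mod 4] by rewrite cF -qE.
exists F, F1; split; first by rewrite cF.
rewrite -cF in qE; apply: has_cycle_embeds.
have [q5|q5] := leqP q 5; last by apply: paley_pancyclic; rewrite -?qE.
apply: (has_cycle_ge_pchar F1 pF); rewrite -qE.
have := dvdn_leq _ (pchar_dvd_card pF); rewrite -qE; lia.
Qed.

Theorem corollary1p4 (n : nat) (hn : 3 <= n) :
  is_paley_index (cycle_graph n) (if 5 <= n then ceilF n else 9).
Proof.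
case: leqP => n5; last first.
  rewrite /ceilF; case: (ex_minnP (ceilF_subproof n)) => m /andP[nm mP] m_min.
  split.
    by split=> //; apply: paley_embeds => //; [rewrite hn | left].
  move=> q [qP [F [F1 [cF /iso_to_subgraphP[f f_inj _]]]]].
  apply: m_min; rewrite qP andbT -cF -(card_ord n).
  exact: leq_card f_inj.
split.
  have P9 : paley_order 9.
    by apply/andP; split=> //; apply/prime_powerP; exists 3, 2.
  by split=> //; apply: paley_embeds => //; [rewrite hn; lia | right].
move=> q [/andP[/prime_powerP[p [k [pp k0 qE]]] q1]].
case=> F [F1 [cF /iso_to_subgraphP[f f_inj f_adj]]].
rewrite leqNgt; apply/negP => q9.
have q_gt1 : 1 < q by rewrite qE -(exp1n k) ltn_exp2r // prime_gt1.
have q5 : #|F| = 5 by move/eqP: q1; rewrite cF; lia.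
have [n3|n4] : n = 3 \/ n = 4 by lia.
  subst n; pose o i (i3 : i < 3) := Ordinal i3.
  have := order5_no_triangle q5 (f_adj (o 0 isT) (o 1 isT) isT)
                                (f_adj (o 1 isT) (o 2 isT) isT).
  by move/negP; apply; apply: (f_adj (o 0 isT) (o 2 isT)).
subst n; pose o i (i4 : i < 4) := Ordinal i4.
have := order5_no_square q5 (f_adj (o 0 isT) (o 1 isT) isT)
  (f_adj (o 1 isT) (o 2 isT) isT) (f_adj (o 2 isT) (o 3 isT) isT).
rewrite !(inj_eq f_inj) => /(_ isT isT) /negP; apply.
by apply: (f_adj (o 3 isT) (o 0 isT)).
Qed.
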